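(* There is a function $P(n)=2^{O(n\lg n)}$ such that for every parity automaton $\mathcal{A}$ with $n$ states over a finite alphabet $\Sigma$ (with any number $k$ of pairs), there is a nondeterministic Büchi automaton with at most $P(n)$ states whose language is $\Sigma^{\omega}\setminus\mathscr{L}(\mathcal{A})$.
   Context: An $\omega$-automaton is a tuple $\mathcal{A}=(\Sigma,Q,Q_0,\Delta,\mathcal{F})$ with finite alphabet $\Sigma$, finite state set $Q$ ($n=|Q|$), initial states $Q_0\subseteq Q$, transitions $\Delta\subseteq Q\times\Sigma\times Q$ and acceptance condition $\mathcal{F}$. A run over $w\in\Sigma^\omega$ is $\varrho\in Q^\omega$ with $\varrho(0)\in Q_0$ and $(\varrho(i),w(i),\varrho(i+1))\in\Delta$ for all $i$; $\mathrm{Inf}(\varrho)$ is the set of states occurring infinitely often. $w$ is accepted if some run over $w$ satisfies $\mathcal{F}$; $\mathscr{L}(\mathcal{A})$ is the set of accepted words. A parity automaton has, for $I=\{1,\dots,k\}$ and $G,B:I\to 2^Q$ with $B(1)\subset G(1)\subset B(2)\subset G(2)\subset\cdots\subset B(k)\subset G(k)$, the acceptance condition: for all $i\in I$, $\mathrm{Inf}(\varrho)\cap G(i)\neq\emptyset$ implies $\mathrm{Inf}(\varrho)\cap B(i)\neq\emptyset$. A Büchi automaton has condition given by $F\subseteq Q$: $\mathrm{Inf}(\varrho)\cap F\neq\emptyset$. *)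

(* Defs.v *)
From mathcomp Require Import all_boot all_order all_algebra.
From mathcomp Require Import all_classical all_reals all_analysis.

Set Implicit Arguments.
Unset Strict Implicit.
Unset Printing Implicit Defensive.

Import Order.TTheory GRing.Theory Num.Theory.
Import numFieldNormedType.Exports.

Local Open Scope classical_set_scope.

Definition Inf (Q : finType) (rho : nat -> Q) : set Q :=
  [set q | forall i : nat, exists2 j : nat, (i <= j)%N & rho j = q].

Definition buchi_cond (Q : finType) (F : {set Q}) (rho : nat -> Q) : Prop :=
  Inf rho `&` [set` F] !=set0.

(* The index set {1, ..., k} is represented by 'I_k = {0, ..., k-1}. *)
Definition parity_cond (Q : finType) (k : nat) (G B : 'I_k -> {set Q})
    (rho : nat -> Q) : Prop :=
  forall i : 'I_k,
    Inf rho `&` [set` G i] !=set0 -> Inf rho `&` [set` B i] !=set0.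

(* B(1) < G(1) < B(2) < G(2) < ... < B(k) < G(k), all inclusions strict. *)
Definition parity_chain (Q : finType) (k : nat) (G B : 'I_k -> {set Q}) : Prop :=
  (forall i : 'I_k, B i \proper G i) /\
  (forall i j : 'I_k, j = i.+1 :> nat -> G i \proper B j).

Record omega_automaton (Sigma : finType) := OmegaAutomaton {
  state : finType;
  init : {set state};
  trans : {set state * Sigma * state};
  acceptance : (nat -> state) -> Prop
}.

Section Language.
Variables (Sigma : finType) (A : omega_automaton Sigma).

Definition is_run (w : nat -> Sigma) (rho : nat -> state A) : Prop :=
  rho 0%N \in init A /\ forall i : nat, (rho i, w i, rho i.+1) \in trans A.

Definition language : set (nat -> Sigma) :=
  [set w | exists2 rho : nat -> state A, is_run w rho & acceptance rho].

Definition is_parity_automaton : Prop :=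
  exists (k : nat) (G B : 'I_k -> {set state A}),
    parity_chain G B /\
    forall rho : nat -> state A, acceptance rho <-> parity_cond G B rho.

Definition is_buchi_automaton : Prop :=
  exists F : {set state A},
    forall rho : nat -> state A, acceptance rho <-> buchi_cond F rho.

End Language.

Section Growth.
Variable R : realType.
Local Open Scope ring_scope.

Definition lg (x : R) : R := ln x / ln 2.

Definition two_pow_O_nlgn (P : nat -> nat) : Prop :=
  exists2 f : nat -> R,
    f =O_\oo (fun n : nat => n%:R * lg n%:R) &
    forall n : nat, (P n)%:R = 2 `^ f n.

End Growth.

(* Main.v *)
(* For a word outside the language, every infinite path of its run graph has an
   odd least recurring priority. Peel such a graph at depth [d], where all
   priorities are at least [2 d]: first the vertices without an infinite path,
   then those whose infinite paths all avoid [2 d]. The latter, without their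
   vertices of priority [2 d + 1], are treated recursively at depth [d + 1], and
   the remaining graph again at depth [d]. Each round lowers the limit inferior
   of the width of the remaining graph, so the rounds form an ordered tree with
   at most [n] leaves. One list of at most [n] branching depths, shared by all
   vertices, describes this tree, and every vertex only needs a depth, a leaf
   and a flag; hence [n ^ O(n)] rankings. The Buechi automaton guesses the list
   and the ranks, checks them locally, and uses a breakpoint construction to
   check that every path meets the flag [1] infinitely often. *)
Require Import Defs.
From mathcomp Require Import all_boot all_order all_algebra.
From mathcomp Require Import all_classical all_reals all_analysis.
From mathcomp Require Import zify.

Set Implicit Arguments.
Unset Strict Implicit.
Unset Printing Implicit Defensive.

(** * Dependent choice and limits inferior *)

Lemma dependent_choice_from (T : Type) (Inv : nat -> T -> Prop)
    (step : nat -> T -> T -> Prop) (l : nat) (x : T) :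
  Inv l x ->
  (forall t y, Inv t y -> exists z, Inv t.+1 z /\ step t y z) ->
  exists f : nat -> T, f l = x /\
    forall t, l <= t -> Inv t (f t) /\ step t (f t) (f t.+1).
Proof.
move=> Ilx next.
have /choice[g gP] : forall ty : nat * T, exists z,
    Inv ty.1 ty.2 -> Inv ty.1.+1 z /\ step ty.1 ty.2 z.
  move=> [t y] /=; have [Ity|nI] := EM (Inv t y); last by exists y.
  by have [z zP] := next _ _ Ity; exists z.
pose h := fix h m := if m is m'.+1 then g (l + m', h m') else x.
have hP m : Inv (l + m) (h m).
  elim: m => [|m IH] /=; first by rewrite addn0.
  by rewrite addnS; case: (gP (l + m, h m) IH).
exists (fun t => h (t - l)); rewrite subnn; split=> // t le_lt.
rewrite -{1 3}(subnKC le_lt) subSn //; split; first exact: hP.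
by case: (gP (l + (t - l), h (t - l)) (hP _)).
Qed.

(** The conclusion describes [v] as the limit inferior of [f]; the induction lowers [w] as long as
    values at most [w] still recur. *)
Lemma liminf_nat (f : nat -> nat) (w : nat) :
  (forall i, exists2 j, i <= j & f j <= w) ->
  exists v, (forall i, exists2 j, i <= j & f j <= v) /\
            (exists i, forall j, i <= j -> v <= f j).
Proof.
elim: w => [|w IH] fw; first by exists 0; split=> //; exists 0.
have [fw'|] := EM (forall i, exists2 j, i <= j & f j <= w); first exact: IH.
move=> /existsNP[i iP]; exists w.+1; split=> //; exists i => j le_ij.
by rewrite ltnNge; apply/negP => le_fw; apply: iP; exists j.
Qed.

(** * Infinite paths in layered graphs of bounded width *)

Section RunGraph.
Variables (Q : finType) (edge : nat -> rel Q).
Implicit Types (D : nat -> {set Q}) (p : nat -> Q).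

Definition is_path D (l : nat) p : Prop :=
  forall i, l <= i -> p i \in D i /\ edge i (p i) (p i.+1).

Definition live D (l : nat) (q : Q) : Prop :=
  exists2 p, is_path D l p & p l = q.

Lemma is_path_suffix D l m p : l <= m -> is_path D l p -> is_path D m p.
Proof. by move=> le_lm Dp i /(leq_trans le_lm)/Dp. Qed.

Lemma is_path_live D l m p : l <= m -> is_path D l p -> live D m (p m).
Proof. by move=> le_lm Dp; exists p => //; apply: is_path_suffix Dp. Qed.

Lemma live_in D l q : live D l q -> q \in D l.
Proof. by move=> [p Dp <-]; case: (Dp l). Qed.

Lemma is_path_cons D l q p :
  q \in D l -> edge l q (p l.+1) -> is_path D l.+1 p ->
  is_path D l (fun i => if i == l then q else p i).
Proof.
move=> Dq eq Dp i; rewrite leq_eqVlt => /predU1P[<-|lt_li].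
  by rewrite eqxx gtn_eqF.
by rewrite (gtn_eqF lt_li) (gtn_eqF (leqW lt_li)); apply: Dp.
Qed.

Lemma live_pred D l q q' :
  q \in D l -> edge l q q' -> live D l.+1 q' -> live D l q.
Proof.
move=> Dq eqq' [p Dp pl]; exists (fun i => if i == l then q else p i).
  by apply: is_path_cons; rewrite ?pl.
by rewrite eqxx.
Qed.

(** Predecessors give, for each [k], a vertex at level [l] with a descending path of [k] edges
    ([desc k]). Since [Q] is finite and [desc] is downward closed in [k], one vertex works for all
    [k]; the same pigeonhole argument passes this property on to a successor. *)
Lemma koenig D l :
  (forall i, l <= i -> exists q, q \in D i) ->
  (forall i q', l <= i -> q' \in D i.+1 -> exists2 q, q \in D i & edge i q q') ->
  exists p, is_path D l p.
Proof.
move=> D0 Dpred.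
pose desc := fix desc k i q := (q \in D i) &&
  if k is k'.+1 then [exists q', edge i q q' && desc k' i.+1 q'] else true.
have descW k m i q : k <= m -> desc m i q -> desc k i q.
  elim: k m i q => [|k IH] [|m] i q //=; first by move=> _ /andP[-> _].
  move=> le_km /andP[-> /existsP[q' /andP[eq' dq']]]; apply/existsP; exists q'.
  by rewrite eq' (IH m).
have pigeon (P : Q -> nat -> Prop) :
    (forall q k m, k <= m -> P q m -> P q k) ->
    (forall k, exists q, P q k) -> exists q, forall k, P q k.
  move=> Pdec Pex; apply: contrapT => /forallNP nP.
  have /choice[g gP] : forall q, exists k, ~ P q k.
    by move=> q; apply/existsNP.
  have [q Pq] := Pex (\max_q g q).
  by apply: (gP q); apply: Pdec Pq; apply: (leq_bigmax (F := g)).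
have descE k i : l <= i -> exists q, desc k i q.
  elim: k i => [|k IH] i le_li.
    by have [q Dq] := D0 _ le_li; exists q; rewrite /= Dq.
  have [q' dq'] := IH i.+1 (leqW le_li).
  have [|q Dq eq] := Dpred i q' le_li; first by case/andP: (descW 0 k _ _ isT dq').
  by exists q; rewrite /= Dq; apply/existsP; exists q'; rewrite eq.
have [q0 dq0] : exists q, forall k, desc k l q.
  apply: pigeon => [q k m|k]; first exact: descW.
  exact: descE.
have [t q dq|f [_ fP]] := dependent_choice_from
    (Inv := fun i q => forall k, desc k i q) (step := edge) dq0.
  have [|k|q' q'P] := pigeon (fun q' k => edge t q q' && desc k t.+1 q').
  - by move=> q' k m le_km /andP[-> /(descW _ _ _ _ le_km)].
  - by have /= /andP[_ /existsP[q' q'P]] := dq k.+1; exists q'.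
  exists q'; split; last by case/andP: (q'P 0).
  by move=> k; case/andP: (q'P k).
exists f => i /fP[df ef]; split=> //.
by have /= := df 0; rewrite andbT.
Qed.

(** The choice sequence carries a path together with the level of its next visit to [X]. The path is
    kept until that visit and then exchanged for another one through the same vertex, so the
    diagonal [(f i).1 i] is again a path. *)
Lemma path_visiting_infinitely_often D (X : Q -> Prop) l q :
  live D l q ->
  (forall i q', live D i q' ->
     exists p j, [/\ is_path D i p, p i = q', i <= j & X (p j)]) ->
  exists2 p, is_path D l p & forall i, exists2 j, i <= j & X (p j).
Proof.
move=> lq visit.
pose Inv i (s : (nat -> Q) * nat) := [/\ is_path D i s.1, i <= s.2 & X (s.1 s.2)].
pose step i (s s' : (nat -> Q) * nat) :=
  s'.1 i.+1 = s.1 i.+1 /\ (i < s.2 -> s' = s).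
have [p [j [Dp _ le_lj Xj]]] := visit _ _ lq.
have [||f [_ fP]] := @dependent_choice_from _ Inv step l (p, j); first by split.
  move=> i [{Dp Xj le_lj}p {}j] [/= Dp le_ij Xj].
  have [lt_ij|le_ji] := ltnP i j.
    by exists (p, j); split=> //; split=> //; exact: is_path_suffix Dp.
  have [p' [j' [Dp' p'i le_ij' Xj']]] := visit _ _ (is_path_live (leqnSn i) Dp).
  by exists (p', j'); split=> //; split=> //=; rewrite ltnNge le_ji.
exists (fun i => (f i).1 i).
  move=> i le_li; have [[Df _ _] [e _]] := fP i le_li.
  by rewrite e; apply: Df.
move=> i; set m := maxn i l.
have le_lm : l <= m by exact: leq_maxr.
have [[_ le_m Xm] _] := fP m le_lm.
have fE k : m <= k -> k <= (f m).2 -> f k = f m.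
  move=> /subnKC <-; elim: (k - m) => [|n IH]; first by rewrite addn0.
  rewrite addnS => lt_n; have fn := IH (ltnW lt_n).
  have [|_ [_ step_n]] := fP (m + n); first lia.
  by rewrite step_n fn.
exists (f m).2; first by apply: leq_trans le_m; exact: leq_maxl.
by rewrite fE.
Qed.

End RunGraph.

(** * Ranks and the ordered tree of branching depths *)

Definition rank : Type := (nat * nat * nat)%type.
Definition depth (x : rank) : nat := x.1.1.
Definition leaf (x : rank) : nat := x.1.2.
Definition flag (x : rank) : nat := x.2.

(* The entries of [t] are the depths at which consecutive leaves of an ordered
   tree branch off, so that two leaves lie below the same vertex of depth [e]
   exactly when they have the same [node t e]. *)
Definition node (t : seq nat) (e l : nat) : nat :=
  count (fun b => b <= e) (take l t).

(** A rank deeper than [e] is given inside the class of vertices whose infinite paths avoid priority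
    [2 e]. This class lies between the remaining graph (flag 2) and the vertices without infinite
    path (flag 0), hence the value 1. *)
Definition flag_at (e : nat) (x : rank) : nat :=
  if depth x == e then flag x else 1.

(** For flags below 3 this encodes the lexicographic order on node and flag in one number. *)
Definition value (t : seq nat) (e : nat) (x : rank) : nat :=
  3 * node t e (leaf x) + flag_at e x.

Definition descends (t : seq nat) (x y : rank) : bool :=
  let e := minn (depth x) (depth y) in value t e y <= value t e x.

Definition shift_leaf (k : nat) (x : rank) : rank :=
  (depth x, k + leaf x, flag x).

Lemma node_catl t s e l : l <= size t -> node (t ++ s) e l = node t e l.
Proof. by move=> le_lt; rewrite /node takel_cat. Qed.

(** In [t ++ d :: s] the leaves of [s] follow the [(size t).+1] leaves of [t]. The entry [d]
    separates the two groups, so at every depth from [d] on the leaves of [s] open new nodes. *)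
Lemma node_catr t s d e l : d <= e ->
  node (t ++ d :: s) e ((size t).+1 + l) = count (fun b => b <= e) t + (node s e l).+1.
Proof.
move=> le_de; rewrite /node take_cat ltnNge (_ : size t <= _); last lia.
by rewrite count_cat (_ : _ - _ = l.+1) /= ?le_de //; lia.
Qed.

Lemma node_count t e l : node t e l <= count (fun b => b <= e) t.
Proof. by rewrite -{2}(cat_take_drop l t) count_cat leq_addr. Qed.

Lemma node_mono t e l l' : l <= l' -> node t e l <= node t e l'.
Proof.
move=> /subnKC <-; rewrite /node takeD count_cat; exact: leq_addr.
Qed.

Lemma node_eq0 t d l : all (fun b => d < b) t -> node t d l = 0.
Proof.
move=> /allP dt; apply/eqP; rewrite /node -leqn0 leqNgt -has_count.
by apply/hasPn => b /mem_take/dt; rewrite -ltnNge.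
Qed.

(** If [l'] lies beyond [l], no entry between them is at most [m], hence none is at most [e]. *)
Lemma node_coarsen t e m l l' : e <= m ->
  node t m l' <= node t m l -> node t e l' <= node t e l.
Proof.
move=> le_em; have [/(node_mono t e)//|/ltnW/subnKC <-] := leqP l' l.
rewrite /node takeD !count_cat -[X in _ <= X -> _]addn0 leq_add2l => /= cm.
rewrite -[X in _ <= X]addn0 leq_add2l; apply: leq_trans cm.
by apply: sub_count => b /leq_trans; apply.
Qed.

Lemma flag_at_le e x : flag x < 3 -> flag_at e x < 3.
Proof. by rewrite /flag_at; case: ifP. Qed.

Lemma descends_catl t s x y :
  leaf x <= size t -> leaf y <= size t -> descends (t ++ s) x y = descends t x y.
Proof. by move=> lx ly; rewrite /descends /value !node_catl. Qed.

Lemma descends_shift t s d x y : d <= depth x -> d <= depth y ->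
  descends s x y ->
  descends (t ++ d :: s) (shift_leaf (size t).+1 x) (shift_leaf (size t).+1 y).
Proof.
move=> dx dy; rewrite /descends; set e := minn (depth x) (depth y).
have valueE z : value (t ++ d :: s) e (shift_leaf (size t).+1 z) =
    3 * (count (fun b => b <= e) t).+1 + value s e z.
  rewrite /value node_catr; last by rewrite leq_min dx dy.
  by rewrite addnA -mulnDr addnS addSn.
by rewrite !valueE leq_add2l.
Qed.

(** The shifted leaf lies past the entry [d], so its node is strictly larger than that of [y], and
    the factor 3 outweighs any flag. *)
Lemma descends_cross t s d x y : d <= depth x -> d <= depth y ->
  leaf y <= size t -> flag y < 3 ->
  descends (t ++ d :: s) (shift_leaf (size t).+1 x) y.
Proof.
move=> dx dy ly fy; rewrite /descends; set e := minn (depth x) (depth y).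
rewrite /value node_catr ?node_catl //; last by rewrite leq_min dx dy.
by have := node_count t e (leaf y); have := flag_at_le e fy; lia.
Qed.

Lemma descends_flag t d x y : all (fun b => d < b) t ->
  minn (depth x) (depth y) = d ->
  flag_at d y <= flag_at d x -> descends t x y.
Proof. by move=> dt xyd; rewrite /descends xyd /value !node_eq0. Qed.

(** Strictly below both depths [flag_at] is 1 on either side, so only the nodes are compared, and
    these coarsen monotonically. *)
Lemma descends_coarsen t e x y : e <= depth x -> e <= depth y ->
  flag x < 3 -> flag y < 3 -> descends t x y -> value t e y <= value t e x.
Proof.
move=> ex ey fx fy; rewrite /descends; set m := minn _ _.
have [-> //|ne_em] := eqVneq e m.
have lt_em : e < m by rewrite ltn_neqAle ne_em leq_min ex ey.
have [lt_ex lt_ey] : e < depth x /\ e < depth y by rewrite /m in lt_em; lia.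
rewrite {1 2}/value => le_m.
have : node t m (leaf y) <= node t m (leaf x).
  by have := flag_at_le m fx; have := flag_at_le m fy; lia.
move=> /(node_coarsen (ltnW lt_em)) le_e.
by rewrite /value /flag_at !gtn_eqF // leq_add2r leq_mul2l.
Qed.

(** * Rankings: they force rejection, and they exist on rejecting graphs *)

Section Ranking.
Variables (Q : finType) (edge : nat -> rel Q) (prio : Q -> nat) (K : nat).
Implicit Types (D : nat -> {set Q}) (p : nat -> Q) (r : nat -> Q -> rank).

Definition rejecting p : Prop :=
  exists2 d, d < K & (forall i, exists2 j, i <= j & prio (p j) = d.*2.+1) /\
                     (exists i, forall j, i <= j -> d.*2 < prio (p j)).

Definition admissible (q : Q) (x : rank) : bool :=
  [&& flag x < 3, (depth x).*2 <= prio q &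
      (flag x == 1) ==> (prio q == (depth x).*2.+1)].

Record ranking D (d : nat) (t : seq nat) r : Prop := Ranking {
  ranking_admissible : forall l q, q \in D l -> admissible q (r l q);
  ranking_depth : forall l q, q \in D l -> d <= depth (r l q) <= K;
  ranking_leaf : forall l q, q \in D l -> leaf (r l q) <= size t;
  ranking_edge : forall l q q', q \in D l -> q' \in D l.+1 -> edge l q q' ->
    descends t (r l q) (r l.+1 q');
  ranking_path : forall l p, is_path edge D l p ->
    exists2 j, l <= j & flag (r j (p j)) = 1 }.

(** Let [e] be the limit inferior of the depths. From some point on the value at [e] cannot
    increase, so it becomes constant and fixes [flag_at e]. A recurring flag 1 makes this constant
    1, whether it occurs at depth [e] or deeper. Hence each late visit to depth [e] has priority
    [2 e + 1], and deeper ranks have priority at least [2 e + 2]. *)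
Lemma ranked_path_rejecting t (r : nat -> rank) p :
  (forall q, prio q <= K.*2) -> (forall i, admissible (p i) (r i)) ->
  (forall i, descends t (r i) (r i.+1)) ->
  (forall i, exists2 j, i <= j & flag (r j) = 1) -> rejecting p.
Proof.
move=> prio_le adm desc good.
have flag3 i : flag (r i) < 3 by case/and3P: (adm i).
have rK i : depth (r i) <= K.
  by case/and3P: (adm i) => _ le_r _; rewrite -leq_double (leq_trans le_r).
have [|e [e_inf [i0 e_ev]]] := @liminf_nat (depth \o r) K.
  by move=> i; exists i => //=.
have vmono i : i0 <= i -> value t e (r i.+1) <= value t e (r i).
  by move=> le_i; apply: descends_coarsen => //; apply: e_ev => //; exact: leqW.
have vmono2 i j : i0 <= i -> i <= j -> value t e (r j) <= value t e (r i).
  move=> le_i /subnKC <-; elim: (j - i) => [|k IH]; first by rewrite addn0.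
  by rewrite addnS; apply: leq_trans IH; apply: vmono; lia.
have [|v [v_inf [i1 v_ev]]] :=
    @liminf_nat (fun i => value t e (r (i0 + i))) (value t e (r i0)).
  by move=> i; exists i => //; apply: vmono2 => //; lia.
have [j1 le_j1 vj1] := v_inf i1.
have vE i : i0 + j1 <= i -> value t e (r i) = v.
  move=> le_i; apply/eqP; rewrite eqn_leq; apply/andP; split.
    by apply: leq_trans vj1; apply: vmono2 => //; lia.
  by rewrite -(@subnKC i0 i); first (apply: v_ev; lia); lia.
have fE i : i0 + j1 <= i -> flag_at e (r i) = v %% 3.
  move=> /vE <-; rewrite /value mulnC modnMDl modn_small //; exact: flag_at_le.
have f1 i : i0 + j1 <= i -> flag_at e (r i) = 1.
  move=> le_i; rewrite fE //; have [j le_j fj] := good (i0 + j1).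
  by rewrite -(fE j le_j) /flag_at; case: ifP.
have prioE i : i0 + j1 <= i -> depth (r i) = e -> prio (p i) = e.*2.+1.
  move=> le_i de; have := f1 i le_i; rewrite /flag_at de eqxx => fi.
  by case/and3P: (adm i) => _ _; rewrite fi de /= => /eqP.
have e_inf' i : exists2 j, i <= j & prio (p j) = e.*2.+1.
  have [j le_j ej] := e_inf (i + (i0 + j1)); exists j; first lia.
  by apply: prioE; [lia | apply/eqP; rewrite eqn_leq ej /=; apply: e_ev; lia].
exists e.
  by have [j _ ej] := e_inf' 0; have := prio_le (p j); rewrite ej; lia.
split=> //; exists (i0 + j1) => i le_i.
have [de|ne] := eqVneq (depth (r i)) e; first by rewrite prioE.
have : e <= depth (r i) by apply: e_ev; lia.
by case/and3P: (adm i) => _ le_r _; lia.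
Qed.

Lemma ranking_exists d D w :
  (forall l q, q \in D l -> d.*2 <= prio q) ->
  (forall l p, is_path edge D l p -> rejecting p) ->
  d <= K -> (forall i, exists2 j, i <= j & #|D j| <= w) ->
  exists t r, [/\ size t <= w.-1, all (fun b => d <= b <= K) t &
                  ranking D d t r].
Proof.
(* The outer induction on [K - d] serves the call at depth [d.+1], the inner one on [w] the call at
   depth [d]. The bound [w.-1] counts the separators between [w] leaves. *)
have [e] := ubnP (K - d); elim: e d D w => // e IHe d D w lt_e.
have [n] := ubnP w; elim: n D w => // n IHn D w lt_n Dprio Drej le_dK Dw.
have admd q c : d.*2 <= prio q -> c < 3 -> (c = 1 -> prio q = d.*2.+1) ->
    admissible q (d, 0, c).
  move=> dq c3 c1; apply/and3P; split=> //.
  by apply/implyP => /eqP/c1/= ->.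
have [[l0 [p0 Dp0]]|noP] := EM (exists l p, is_path edge D l p); last first.
  exists [::], (fun _ _ => (d, 0, 0)); split=> //; split=> //.
  - by move=> l q /Dprio dq; apply: admd.
  - by move=> l q _ /=; rewrite leqnn.
  - by move=> *; rewrite /descends leqnn.
  - by move=> l p Dp; case: noP; exists l, p.
pose inS l q := live edge D l q /\
  forall p, is_path edge D l p -> p l = q -> forall i, l <= i -> prio (p i) <> d.*2.
pose S l := finset (fun q => `[< inS l q >]).
pose R l := finset (fun q => `[< live edge D l q >] && ~~ `[< inS l q >]).
have SP l q : reflect (inS l q) (q \in S l) by rewrite inE; apply: asboolP.
have RP l q : reflect (live edge D l q /\ ~ inS l q) (q \in R l).
  rewrite inE; apply: (iffP andP) => -[/asboolP ? H]; split=> //; last exact/asboolPn.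
  exact/asboolPn.
have SD l q : q \in S l -> q \in D l by move=> /SP[/live_in].
have RD l q : q \in R l -> q \in D l by move=> /RP[/live_in].
have S_next l q q' : q \in S l -> edge l q q' -> live edge D l.+1 q' -> q' \in S l.+1.
  move=> Sq eq lq'; apply/SP; split=> // p Dp pq' i lt_i.
  have [lq /(_ (fun i => if i == l then q else p i))] := SP _ _ Sq.
  rewrite eqxx => /(_ _ erefl i (ltnW lt_i)); rewrite (gtn_eqF lt_i); apply.
  by apply: is_path_cons; rewrite ?pq' //; apply: SD.
have S_path l p : is_path edge D l p -> p l \in S l -> is_path edge S l p.
  move=> Dp Sp.
  have Spi i : l <= i -> p i \in S i.
    move=> /subnKC <-; elim: (i - l) => [|k IH]; first by rewrite addn0.
    rewrite addnS; apply: S_next IH _ _; first by case: (Dp (l + k)); lia.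
    by apply: is_path_live Dp; lia.
  by move=> i le_i; split; [exact: Spi | case: (Dp i le_i)].
(* Were [S] empty, every live vertex would have a path reaching priority [d.*2], hence some path
   would do so infinitely often. As no priority is below [d.*2], such a path is not rejecting. *)
have [l1 [q1 Sq1]] : exists l q, q \in S l.
  apply: contrapT => /forallNP noS.
  have [||p Dp p_inf] := @path_visiting_infinitely_often _ edge D
      (fun q => prio q = d.*2) l0 (p0 l0).
  - exact: is_path_live Dp0.
  - move=> i q lq; apply: contrapT => noV; apply: (noS i); exists q; apply/SP.
    split=> // p Dp pq j le_j pj; apply: noV.
    by exists p, j; split.
  have [d' _ [d'_inf [i d'_ev]]] := Drej _ _ Dp.
  have [j le_j pj] := p_inf i.
  have [j' le_j' pj'] := d'_inf l0.
  have := d'_ev _ le_j; have := Dprio _ _ (proj1 (Dp _ le_j')); rewrite pj pj'; lia.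
have S_prio l q : q \in S l -> d.*2 < prio q.
  move=> Sq; rewrite ltn_neqAle (Dprio l q) ?andbT; last exact: SD.
  have [[p Dp pq] /(_ p Dp pq l (leqnn l))] := SP _ _ Sq.
  by rewrite pq => /eqP; rewrite eq_sym.
have lt_dK : d < K.
  have [d' lt_d' [d'_inf _]] := Drej _ _ Dp0.
  have [j le_j pj] := d'_inf l0.
  have := Dprio _ _ (proj1 (Dp0 _ le_j)); rewrite pj; lia.
have [p1 Sp1] : exists p, is_path edge S l1 p.
  by have [[p Dp pq] _] := SP _ _ Sq1; exists p; apply: S_path; rewrite ?pq.
have cardSR l : #|S l| + #|R l| <= #|D l|.
  rewrite -cardsUI (_ : S l :&: R l = finset.set0) ?cards0 ?addn0.
    apply/subset_leq_card/fintype.subsetP => q.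
    by rewrite finset.in_setU => /orP[/SD|/RD].
  apply/setP => q; rewrite finset.in_setI finset.in_set0.
  by apply/negP => /andP[/SP ? /RP[]].
have [|w1 [w1_inf [i1 w1_ev]]] := @liminf_nat (fun l => #|S l|) w.
  by move=> i; have [j le_j Dj] := Dw i; exists j => //; have := cardSR j; lia.
have [|w2 [w2_inf [i2 w2_ev]]] := @liminf_nat (fun l => #|R l|) w.
  by move=> i; have [j le_j Dj] := Dw i; exists j => //; have := cardSR j; lia.
(* At a late level of width at most [w], the disjoint sets [S j] and [R j] have at least [w1] and
   [w2] elements. With [0 < w1] this makes [w2] smaller than [w]. *)
have le_w12 : w1 + w2 <= w.
  have [j le_j Dj] := Dw (i1 + i2); have := w1_ev j; have := w2_ev j.
  have := cardSR j; lia.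
have w1_gt0 : 0 < w1.
  have [j le_j Sj] := w1_inf l1; apply: leq_trans Sj.
  by apply/card_gt0P; exists (p1 j); case: (Sp1 j le_j).
(* On [S] all priorities exceed [d.*2]; without [d.*2.+1] they are at least [d.+1.*2], as depth
   [d.+1] demands. *)
pose S' l := finset (fun q => (q \in S l) && (prio q != d.*2.+1)).
have S'S l q : q \in S' l -> q \in S l by rewrite inE => /andP[].
have [|||||t1 [r1 [t1_size t1_all r1P]]] := IHe d.+1 S' w1 => //.
- lia.
- move=> l q S'q; have := S_prio _ _ (S'S _ _ S'q).
  by move: S'q; rewrite inE => /andP[_]; lia.
- move=> l p S'p; apply: (Drej l) => i /S'p[/S'S/SD ? ?]; by split.
- move=> i; have [j le_j Sj] := w1_inf i; exists j => //.
  by apply: leq_trans Sj; apply/subset_leq_card/fintype.subsetP => q /S'S.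
(* Edges lead from [R] to [S] to the vertices without infinite path, never back, so the flags 2, 1,
   0 do not increase along edges. *)
pose r0 l q : rank := if q \in S l then if prio q == d.*2.+1 then (d, 0, 1) else r1 l q
  else if q \in R l then (d, 0, 2) else (d, 0, 0).
have S'P l q : q \in S l -> prio q != d.*2.+1 -> q \in S' l.
  by move=> ? ?; rewrite inE; apply/andP.
have t1_gt : all (fun b => d < b) t1 by apply: sub_all t1_all => b /andP[].
have r0_adm l q : q \in D l -> admissible q (r0 l q).
  move=> Dq; have dq := Dprio _ _ Dq; rewrite /r0.
  have [Sq|_] := boolP (q \in S l); last by case: ifP => _; apply: admd.
  have [pq|npq] := eqVneq; first exact: admd.
  by apply: ranking_admissible r1P _ _ _; apply: S'P.
have r0_depth l q : q \in D l -> d <= depth (r0 l q) <= K.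
  move=> Dq; rewrite /r0.
  have [Sq|_] := boolP (q \in S l); last by case: ifP => _; rewrite /depth /= leqnn.
  have [pq|npq] := eqVneq; first by rewrite /depth /= leqnn.
  by have /andP[/ltnW -> ->] := ranking_depth r1P (S'P _ _ Sq npq).
have r0_leaf l q : q \in D l -> leaf (r0 l q) <= size t1.
  move=> Dq; rewrite /r0.
  have [Sq|_] := boolP (q \in S l); last by case: ifP => _.
  have [pq|npq] := eqVneq; first by [].
  exact: ranking_leaf r1P _ _ (S'P _ _ Sq npq).
have r0_flag l q : q \in D l -> flag_at d (r0 l q) =
    if q \in S l then 1 else if q \in R l then 2 else 0.
  move=> Dq; rewrite /r0 /flag_at.
  have [Sq|_] := boolP (q \in S l); last by case: (q \in R l); rewrite /depth /= eqxx.
  have [pq|npq] := eqVneq (prio q) d.*2.+1; first by rewrite /depth /= eqxx.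
  by have /andP[/gtn_eqF -> _] := ranking_depth r1P (S'P _ _ Sq npq).
have r0_S l q : q \in D l -> d < depth (r0 l q) -> q \in S' l /\ r0 l q = r1 l q.
  move=> Dq; rewrite /r0.
  have [Sq|_] := boolP (q \in S l); last by case: ifP => _; rewrite /depth /= ltnn.
  have [pq|npq] := eqVneq (prio q) d.*2.+1; first by rewrite /depth /= ltnn.
  by split=> //; apply: S'P.
have live_SR l q : live edge D l q -> q \notin S l -> q \in R l.
  by move=> lq nSq; apply/RP; split=> //; apply/SP.
have not_live l q : q \in D l -> q \notin S l -> q \notin R l -> ~ live edge D l q.
  by move=> Dq nS nR lq; move: nR; rewrite live_SR.
have SR_class l q q' : q \in D l -> q' \in D l.+1 -> edge l q q' ->
    q' \in R l.+1 -> q \in R l.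
  move=> Dq Dq' eq /RP[lq' nSq']; apply: live_SR; first exact: live_pred lq'.
  by apply/negP => Sq; apply: nSq'; apply/SP; apply: S_next Sq eq lq'.
have r0_edge l q q' : q \in D l -> q' \in D l.+1 -> edge l q q' ->
    descends t1 (r0 l q) (r0 l.+1 q').
  move=> Dq Dq' eq.
  have /andP[dq _] := r0_depth _ _ Dq; have /andP[dq' _] := r0_depth _ _ Dq'.
  (* If one end has depth [d], the flags at [d] decide; otherwise both ends lie in [S'] and [r1]
     applies. *)
  have [md|md] := leqP (minn (depth (r0 l q)) (depth (r0 l.+1 q'))) d.
    apply: descends_flag t1_gt _ _; first by apply/eqP; rewrite eqn_leq md leq_min dq.
    rewrite !r0_flag //; have [Sq'|nSq'] := boolP (q' \in S l.+1).
      have [//|nSq] := boolP (q \in S l); rewrite (live_SR l q) //.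
      by apply: live_pred eq _ => //; case/SP: Sq'.
    have [Rq'|//] := boolP (q' \in R l.+1).
    have Rq := SR_class _ _ _ Dq Dq' eq Rq'; rewrite Rq.
    by case: ifP => // /SP Sq; case/RP: Rq.
  move: md; rewrite leq_min => /andP[/r0_S[//|S'q ->] /r0_S[//|S'q' ->]].
  exact: ranking_edge r1P _ _ _ S'q S'q' eq.
have r0_path l p : is_path edge S l p -> exists2 j, l <= j & flag (r0 j (p j)) = 1.
  move=> Sp; have [[j le_j pj]|nj] := EM (exists2 j, l <= j & prio (p j) = d.*2.+1).
    by exists j => //; rewrite /r0 pj eqxx; case: (Sp j le_j) => ->.
  have [|j le_j fj] := ranking_path r1P (l := l) (p := p).
    move=> i le_i; case: (Sp i le_i) => Si ei; split=> //; apply: S'P => //.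
    by apply/eqP => pi; apply: nj; exists i.
  exists j => //; rewrite /r0; case: (Sp j le_j) => -> _.
  by case: eqP => // pj; case: nj; exists j.
have D_path l p : is_path edge D l p ->
    (exists2 j, l <= j & is_path edge S j p) \/ is_path edge R l p.
  move=> Dp; have [[j le_j Sj]|nj] := EM (exists2 j, l <= j & p j \in S j).
    by left; exists j => //; apply: S_path Sj; apply: is_path_suffix Dp.
  right=> i le_i; split; last by case: (Dp i le_i).
  apply: live_SR; first exact: is_path_live Dp.
  by apply/negP => Si; apply: nj; exists i.
have t1_all' : all (fun b => d <= b <= K) t1.
  by apply: sub_all t1_all => b /andP[/ltnW -> ->].
(* If [R] has no infinite path, every infinite path ends up in [S] and [r0] suffices. *)
have [[l2 [p2 Rp2]]|noRP] := EM (exists l p, is_path edge R l p); last first.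
  exists t1, r0; split=> //; first by lia.
  split=> // l p /D_path[[j le_j Sp]|Rp]; last by case: noRP; exists l, p.
  by have [k le_k fk] := r0_path _ _ Sp; exists k => //; lia.
have w2_gt0 : 0 < w2.
  have [j le_j Rj] := w2_inf l2; apply: leq_trans Rj.
  by apply/card_gt0P; exists (p2 j); case: (Rp2 j le_j).
have [|||||t2 [r2 [t2_size t2_all r2P]]] := IHn R w2 => //.
- lia.
- by move=> l q /RD/Dprio.
- by move=> l p Rp; apply: (Drej l) => i /Rp[/RD ? ?]; split.
(* [R] receives the later leaves, since edges leave [R] but never enter it from outside. The length
   is at most [(w1 - 1) + 1 + (w2 - 1)]. *)
exists (t1 ++ d :: t2), (fun l q =>
  if q \in R l then shift_leaf (size t1).+1 (r2 l q) else r0 l q).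
split.
- by rewrite size_cat /=; lia.
- by rewrite all_cat /= t1_all' t2_all leqnn le_dK.
split.
- move=> l q Dq; case: ifP => Rq; last exact: r0_adm.
  exact: (ranking_admissible r2P).
- move=> l q Dq; case: ifP => Rq; last exact: r0_depth.
  exact: (ranking_depth r2P).
- move=> l q Dq; rewrite size_cat /=; case: ifP => Rq.
    by rewrite /leaf /= addnS addSn ltnS leq_add2l; apply: (ranking_leaf r2P Rq).
  by have := r0_leaf _ _ Dq; lia.
- move=> l q q' Dq Dq' eq.
  have /andP[dq _] := r0_depth _ _ Dq; have /andP[dq' _] := r0_depth _ _ Dq'.
  case: ifP => Rq; case: ifP => Rq'.
  + have /andP[dq2 _] := ranking_depth r2P Rq.
    have /andP[dq2' _] := ranking_depth r2P Rq'.
    by apply: descends_shift => //; apply: ranking_edge r2P _ _ _ Rq Rq' eq.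
  + have /andP[dq2 _] := ranking_depth r2P Rq.
    apply: descends_cross => //; first exact: r0_leaf.
    by case/and3P: (r0_adm _ _ Dq').
  + by rewrite (SR_class _ _ _ Dq Dq' eq Rq') in Rq.
  + by rewrite descends_catl ?r0_edge // r0_leaf.
- move=> l p /D_path[[j le_j Sp]|Rp].
    have [k le_k fk] := r0_path _ _ Sp; exists k; first lia.
    have [Sk _] := Sp _ le_k.
    by case: ifP => // /RP[_ nS]; case: nS; apply/SP.
  have [j le_j fj] := ranking_path r2P Rp; exists j => //.
  by case: (Rp j le_j) => -> _.
Qed.

End Ranking.

(** * From parity chains to priorities *)

Lemma Inf_meets (Q : finType) (X : {set Q}) (rho : nat -> Q) :
  (Inf rho `&` [set` X] !=set0)%classic <->
  forall i, exists2 j, i <= j & rho j \in X.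
Proof.
split=> [[q [qI /= qX]] i|Xinf].
  by have [j le_j rj] := qI i; exists j; rewrite ?rj.
apply: contrapT => /forallNP noq.
have /choice[g gP] : forall q, exists i, q \in X -> forall j, i <= j -> rho j <> q.
  move=> q; have [qX|nqX] := boolP (q \in X); last by exists 0.
  have /existsNP[i iP] : ~ Inf rho q by move=> qI; apply: (noq q); split.
  by exists i => _ j le_j rj; apply: iP; exists j.
have [j le_j rjX] := Xinf (\max_q g q).
by apply: (gP (rho j) rjX j) => //; apply: leq_trans le_j; exact: leq_bigmax.
Qed.

Section Priority.
Variables (Q : finType) (k : nat) (G B : 'I_k -> {set Q}).
Hypothesis chainGB : parity_chain G B.

(** The sets [B] and [G] are interleaved into one increasing sequence that ends in the whole state
    set; the priority of a state is the first index whose set contains it. *)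
Definition chain (m : nat) : {set Q} :=
  if insub m./2 is Some i then if odd m then G i else B i else [set: Q].

Lemma chain_even (i : 'I_k) : chain i.*2 = B i.
Proof. by rewrite /chain doubleK valK odd_double. Qed.

Lemma chain_odd (i : 'I_k) : chain i.*2.+1 = G i.
Proof. by rewrite /chain -[_./2]/(uphalf _) uphalf_double valK /= odd_double. Qed.

Lemma chain_top m : k.*2 <= m -> chain m = [set: Q].
Proof. by move=> le_km; rewrite /chain insubF //; lia. Qed.

Lemma chain_proper m : m.+1 < k.*2 -> chain m \proper chain m.+1.
Proof.
have [BG GB] := chainGB; move=> lt_m.
move: (m./2) (odd_double_half m) => i; case: (odd m) => /= mE; subst m.
  have lt_i : i < k by lia.
  have lt_i' : i.+1 < k by lia.
  rewrite add1n -doubleS (chain_odd (Ordinal lt_i)) (chain_even (Ordinal lt_i')).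
  exact: GB.
have lt_i : i < k by lia.
by rewrite add0n (chain_even (Ordinal lt_i)) (chain_odd (Ordinal lt_i)).
Qed.

Lemma chain_mono m m' : m <= m' -> chain m \subset chain m'.
Proof.
move=> /subnKC <-; elim: (m' - m) => [|j IH]; first by rewrite addn0.
rewrite addnS; apply: fintype.subset_trans IH _.
have [lt_k|le_k] := ltnP (m + j).+1 k.*2; first exact/proper_sub/chain_proper.
by rewrite (chain_top le_k) finset.subsetT.
Qed.

Lemma in_chain_ex q : exists m, q \in chain m.
Proof. by exists k.*2; rewrite chain_top. Qed.

Definition prio (q : Q) : nat := ex_minn (in_chain_ex q).

Lemma prio_leE q m : (prio q <= m) = (q \in chain m).
Proof.
rewrite /prio; case: ex_minnP => j qj jmin; apply/idP/idP => [le_jm|/jmin //].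
exact: (fintype.subsetP (chain_mono le_jm)).
Qed.

Lemma prio_bound q : prio q <= k.*2.
Proof. by rewrite prio_leE chain_top. Qed.

(** Strict inclusions give each [G i] more than [i] states. This is what makes the final bound
    independent of the number of pairs. *)
Lemma chain_length : k <= #|Q|.
Proof.
have cardG (m : nat) : m < k -> m < #|chain m.*2.+1|.
  elim: m => [|m IH] lt_m.
    by apply: leq_ltn_trans (leq0n _) (proper_card (chain_proper _)); lia.
  apply: leq_ltn_trans (IH (ltnW lt_m)) _; rewrite -[m.+1.*2]/(m.*2.+2).
  by apply: ltn_trans (proper_card (chain_proper _)) (proper_card (chain_proper _)); lia.
case: k cardG => // k' cardG.
exact: leq_trans (cardG k' (leqnn _)) (max_card _).
Qed.

(** Pair [i] is violated when [G i] recurs, so that priorities at most [2 i + 1] recur, while [B i]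
    does not, so that priorities eventually exceed [2 i]. *)
Lemma parity_cond_prio rho : parity_cond G B rho <-> ~ rejecting prio k rho.
Proof.
split=> [par [d lt_dk [d_inf [i0 d_ev]]]|nrej i /Inf_meets Ginf].
  have /Inf_meets Binf : (Inf rho `&` [set` B (Ordinal lt_dk)] !=set0)%classic.
    apply: par; apply/Inf_meets => i; have [j le_j pj] := d_inf i; exists j => //.
    by rewrite -chain_odd -prio_leE pj.
  have [j /d_ev lt_d] := Binf i0.
  by rewrite -chain_even -prio_leE leqNgt lt_d.
apply/Inf_meets; apply: contrapT => /existsNP[i0 noB]; apply: nrej.
have ev j : i0 <= j -> i.*2 < prio (rho j).
  move=> le_j; rewrite ltnNge prio_leE chain_even.
  by apply/negP => Bj; apply: noB; exists j.
exists i => //; split; last by exists i0.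
move=> i1; have [j le_j Gj] := Ginf (maxn i0 i1); exists j; first lia.
have := ev j; move: Gj; rewrite -chain_odd -prio_leE; lia.
Qed.

End Priority.

Lemma rejecting_tail (Q : finType) (pr : Q -> nat) K l (p p' : nat -> Q) :
  (forall i, l <= i -> p i = p' i) -> rejecting pr K p -> rejecting pr K p'.
Proof.
move=> pp' [d lt_d [d_inf [i0 d_ev]]]; exists d => //; split.
  move=> i; have [j le_j pj] := d_inf (maxn l i); exists j; first lia.
  by rewrite -pp' //; lia.
by exists (maxn l i0) => j le_j; rewrite -pp'; [apply: d_ev|]; lia.
Qed.

(** * The complementing Büchi automaton *)

Definition rank_code (n : nat) : finType := ('I_n.+1 * 'I_n.+1 * 'I_3)%type.

Definition decode n (x : rank_code n) : rank := (val x.1.1, val x.1.2, val x.2).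

Definition encode n (x : rank) : rank_code n :=
  (inord (depth x), inord (leaf x), inord (flag x)).

Lemma encodeK n x : depth x <= n -> leaf x <= n -> flag x < 3 ->
  decode (encode n x) = x.
Proof. by case: x => [[d l] c] dn ln c3; rewrite /decode /= !inordK. Qed.

Section Complement.
Variables (Sigma : finType) (A : omega_automaton Sigma).
Variables (pr : state A -> nat).
Let n := #|state A|.

(* A state consists of the guessed branching depths, the guessed ranks of the
   reachable states of [A], and the breakpoint set of Miyano and Hayashi: the
   ends of the runs that have met no flag [1] since the last breakpoint. *)
Definition comp_state : finType :=
  (n.-tuple 'I_n.+1 * {ffun state A -> option (rank_code n)} * {set state A})%type.

Definition branching (s : comp_state) : seq nat := map val s.1.1.

Definition rank_of (s : comp_state) (q : state A) : option rank :=
  omap (@decode n) (s.1.2 q).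

Definition coherent (s : comp_state) : bool :=
  [forall q, if rank_of s q is Some x then admissible pr q x else true].

Definition comp_init : {set comp_state} :=
  finset (fun s => coherent s && [forall q in init A, rank_of s q : bool]).

Definition consistent (s : comp_state) (a : Sigma) (s' : comp_state) : bool :=
  [forall q, forall q', ((q, a, q') \in trans A) ==>
    if rank_of s q is Some x then
      if rank_of s' q' is Some y then descends (branching s) x y else false
    else true].

Definition unflagged (s : comp_state) (q : state A) : bool :=
  if rank_of s q is Some x then flag x != 1 else false.

Definition next_owing (s : comp_state) (a : Sigma) (s' : comp_state) : {set state A} :=
  finset (fun q' => unflagged s' q' &&
    ((s.2 == finset.set0) || [exists q in s.2, (q, a, q') \in trans A])).

Definition comp_trans : {set comp_state * Sigma * comp_state} :=
  finset (fun e => let: (s, a, s') := e in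
    [&& s'.1.1 == s.1.1, coherent s', consistent s a s' &
        s'.2 == next_owing s a s']).

Definition comp_final : {set comp_state} := finset (fun s => s.2 == finset.set0).

Definition complement : omega_automaton Sigma :=
  OmegaAutomaton comp_init comp_trans (buchi_cond comp_final).

(** The count is the [n]-th power of [(n + 1) (3 (n + 1)^2 + 1) 2], which is at most
    [(2 n + 2)^4]. *)
Lemma card_comp_state : #|comp_state| <= (2 * n + 2) ^ (4 * n).
Proof.
rewrite !card_prod card_tuple card_ffun card_option !card_prod !card_ord.
rewrite -(cardsT {set _}) -powersetT card_powerset cardsT.
rewrite -/n -!expnMn expnM.
have [->//|n_gt0] := posnP n.
by rewrite leq_exp2r // !expnS expn0; nia.
Qed.

Section Language.
Variable K : nat.
Hypothesis accE : forall rho, acceptance (o := A) rho <-> ~ rejecting pr K rho.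
Hypothesis prK : forall q, pr q <= K.*2.
Variable w : nat -> Sigma.

(** The guessed ranks along any run of [A] satisfy [ranked_path_rejecting], so no run is
    accepting. *)
Lemma complement_sound : language complement w -> ~ language A w.
Proof.
move=> [s [s0 s_trans] /Inf_meets s_inf] [rho [rho0 rho_trans] /accE]; apply.
move: s0; rewrite inE => /andP[coh0 /forallP dom0].
have sP i : [/\ (s i.+1).1.1 = (s i).1.1, coherent (s i.+1),
    consistent (s i) (w i) (s i.+1) & (s i.+1).2 = next_owing (s i) (w i) (s i.+1)].
  by have := s_trans i; rewrite inE => /and4P[/eqP ? ? ? /eqP ?]; split.
(* The default never occurs: [rE] shows that all states of the run are ranked. *)
pose r i := odflt (0, 0, 0) (rank_of (s i) (rho i)).
have rE i : rank_of (s i) (rho i) = Some (r i).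
  rewrite /r; elim: i => [|i IH].
    by have := dom0 (rho 0); rewrite rho0; case: rank_of.
  have [_ _ /forallP/(_ (rho i))/forallP/(_ (rho i.+1)) cons _] := sP i.
  by move: cons; rewrite rho_trans IH; case: rank_of.
have bE i : branching (s i) = branching (s 0).
  by elim: i => // i <-; rewrite /branching; case: (sP i) => ->.
apply: (@ranked_path_rejecting _ pr K (branching (s 0)) r rho prK).
- move=> i; have coh : coherent (s i) by case: i => // i; case: (sP i).
  by move/forallP/(_ (rho i)): coh; rewrite rE.
- move=> i; have [_ _ /forallP/(_ (rho i))/forallP/(_ (rho i.+1)) cons _] := sP i.
  by move: cons; rewrite rho_trans !rE bE.
(* Without further flags 1 the run enters the breakpoint set right after the next breakpoint and
   never leaves it, so no other breakpoint follows. *)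
move=> i; apply: contrapT => noflag.
have unfl j : i <= j -> unflagged (s j) (rho j).
  by move=> le_j; rewrite /unflagged rE; apply/eqP => fj; apply: noflag; exists j.
have [j le_j] := s_inf i; rewrite inE => /eqP sj.
have owe k : rho (j.+1 + k) \in (s (j.+1 + k)).2.
  elim: k => [|k IH].
    by rewrite addn0; have [_ _ _ ->] := sP j; rewrite inE sj eqxx unfl //; lia.
  rewrite addnS; have [_ _ _ ->] := sP (j.+1 + k).
  rewrite inE unfl; last lia.
  by apply/orP; right; apply/existsP; exists (rho (j.+1 + k)); rewrite IH rho_trans.
have [j' le_j'] := s_inf j.+1; rewrite inE => /eqP sj'.
by have := owe (j' - j.+1); rewrite subnKC // sj' inE.
Qed.

Hypothesis Kn : K <= n.

Let edge (i : nat) : rel (state A) := fun q q' => (q, w i, q') \in trans A.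

Fixpoint reachable (i : nat) : {set state A} :=
  if i is i'.+1 then
    finset (fun q' => [exists q in reachable i', (q, w i', q') \in trans A])
  else init A.

(** Each induction step prepends a reachable predecessor, until level 0 is met. *)
Lemma reachable_path_run l p : is_path edge reachable l p ->
  exists2 rho, is_run (A := A) w rho & forall i, l <= i -> rho i = p i.
Proof.
elim: l p => [|l IH] p Dp.
  exists p => //; split; first by case: (Dp 0).
  by move=> i; case: (Dp i).
have [] := Dp l.+1 (leqnn _); rewrite inE => /existsP[q /andP[Dq eq]] _.
have [rho rho_run rhoE] := IH _ (is_path_cons Dq eq Dp).
exists rho => // i lt_i; rewrite rhoE ?(gtn_eqF lt_i) //; exact: ltnW.
Qed.

(** The automaton guesses a ranking of the reachable graph, of width at most [n]. If breakpoints
    ceased, König's lemma would give an infinite path of owing states, on which flag 1 never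
    occurs. *)
Lemma complement_complete : ~ language A w -> language complement w.
Proof.
move=> nLw.
have rej l p : is_path edge reachable l p -> rejecting pr K p.
  move=> /reachable_path_run[rho rho_run rhoE]; apply: rejecting_tail rhoE _.
  apply: contrapT => nrej; apply: nLw; exists rho => //; exact/accE.
have [|||i|t [r [t_size t_all rP]]] := @ranking_exists _ edge pr K 0 reachable n => //.
- by exists i => //; apply: max_card.
have le_tn : size t <= n by lia.
(* The list is padded to the fixed length [n]; leaves are at most [size t], so the padding leaves
   [descends] unchanged. *)
pose u := t ++ nseq (n - size t) 0.
have u_size : size (map (@inord n) u) == n.
  by rewrite size_map size_cat size_nseq subnKC.
have uE : map val (map (@inord n) u) = u.
  rewrite -map_comp; apply: map_id_in => b; rewrite mem_cat => /orP[bt|].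
    by rewrite /= inordK //; have /andP[_] := allP t_all _ bt; lia.
  by rewrite mem_nseq => /andP[_ /eqP ->] /=; rewrite inordK.
pose ranks i : {ffun state A -> option (rank_code n)} :=
  [ffun q => if q \in reachable i then Some (encode n (r i q)) else None].
(* The empty set stands in for the breakpoint set being defined, as [next_owing] reads only the
   ranks of its target. *)
pose owing := fix owing i : {set state A} := if i is i'.+1 then
  next_owing (Tuple u_size, ranks i', owing i') (w i')
    (Tuple u_size, ranks i'.+1, finset.set0)
  else finset.set0.
pose s i : comp_state := (Tuple u_size, ranks i, owing i).
have rankE i q : rank_of (s i) q = if q \in reachable i then Some (r i q) else None.
  rewrite /rank_of ffunE; case: ifP => //= Dq; rewrite encodeK //.
  - by have /andP[_] := ranking_depth rP Dq; lia.
  - by have := ranking_leaf rP Dq; lia.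
  - by case/and3P: (ranking_admissible rP Dq).
have coh i : coherent (s i).
  apply/forallP => q; rewrite rankE; case: ifP => // Dq.
  exact: (ranking_admissible rP).
exists s; first split.
- rewrite inE coh; apply/forallP => q; apply/implyP => q0.
  by rewrite rankE /= q0.
- move=> i; rewrite inE; apply/and4P; split=> //.
  apply/forallP => q; apply/forallP => q'; apply/implyP => eq.
  rewrite !rankE; case: ifP => // Dq.
  have Dq' : q' \in reachable i.+1 by rewrite inE; apply/existsP; exists q; rewrite Dq.
  rewrite Dq' /branching /= uE descends_catl.
  + exact: ranking_edge rP _ _ _ Dq Dq' eq.
  + exact: (ranking_leaf rP).
  + exact: (ranking_leaf rP).
apply/Inf_meets => i; apply: contrapT => noempty.
have owing_path : exists p, is_path edge owing i p.
  apply: koenig => [j le_j|j q' le_j].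
    apply/finset.set0Pn/eqP => oj; apply: noempty; exists j => //.
    by rewrite inE /= oj.
  rewrite inE => /andP[_ /orP[/eqP oj|/existsP[q /andP[oq eq]]]]; last by exists q.
  by case: noempty; exists j => //; rewrite inE; apply/eqP.
have [p op] := owing_path.
(* Beyond [i] the level is a successor, where [owing] unfolds to [next_owing]. *)
have unfl j : i < j -> p j \in reachable j /\ flag (r j (p j)) != 1.
  case: j => // j lt_j; have [] := op j.+1 (ltnW lt_j).
  rewrite inE => /andP[unf _] _; move: unf.
  rewrite /unflagged -[rank_of _ _]/(rank_of (s j.+1) (p j.+1)) rankE.
  by case: ifP.
have [|j lt_j fj] := ranking_path rP (l := i.+1) (p := p).
  by move=> j lt_j; split; [case: (unfl j lt_j) | case: (op j (ltnW lt_j))].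
by have [_] := unfl j lt_j; rewrite fj.
Qed.

End Language.
End Complement.

(** * Growth of the state bound *)

Section Asymptotics.
Import Order.TTheory GRing.Theory Num.Theory.
Local Open Scope ring_scope.

(** The exponent is [4 n lg (2 n + 2)]. For [n >= 2] one has [2 n + 2 <= n ^ 3], hence the constant
    [12 = 4 * 3]. *)
Lemma state_bound_two_pow_O_nlgn (R : realType) :
  two_pow_O_nlgn R (fun n => (2 * n + 2) ^ (4 * n))%N.
Proof.
have ln2 : 0 < ln (2 : R) by rewrite ln_gt0 // ltr1n.
pose f (n : nat) : R := (4 * n)%N%:R * lg (2 * n + 2)%N%:R.
have base0 (n : nat) : 0 < (2 * n + 2)%N%:R :> R by rewrite ltr0n; lia.
exists f; last first.
  move=> n; rewrite /powR pnatr_eq0 /= /f /lg mulrA mulfVK ?gt_eqF //.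
  by rewrite natrX expRM_natl lnK // posrE.
apply/eqOP; near=> c; near=> n.
have n2 : (2 <= n)%N by near: n; exact: nbhs_infty_ge.
have lgn : 0 <= lg n%:R :> R.
  by rewrite /lg divr_ge0 ?ln_ge0 // ?(ltW ln2) // ler1n; lia.
have lgb : lg (2 * n + 2)%N%:R <= 3 * lg n%:R :> R.
  rewrite /lg mulrA ler_pM2r ?invr_gt0 // mulr_natl -lnXn ?ltr0n; last lia.
  rewrite ler_ln ?posrE ?exprn_gt0 ?ltr0n; try lia.
  by rewrite -natrX ler_nat !expnS expn0; nia.
have lgb0 : 0 <= lg (2 * n + 2)%N%:R :> R.
  by rewrite /lg divr_ge0 ?ln_ge0 // ?(ltW ln2) // ler1n; lia.
have g_ge0 : 0 <= n%:R * lg n%:R :> R by exact: mulr_ge0.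
have f_ge0 : 0 <= f n by exact: mulr_ge0.
rewrite (ger0_norm f_ge0) (ger0_norm g_ge0).
apply: (@le_trans _ _ (12 * (n%:R * lg n%:R))).
  rewrite /f natrM (_ : 12 * _ = 4%:R * n%:R * (3 * lg n%:R)).
    by rewrite ler_wpM2l // mulr_ge0.
  by rewrite mulrACA -natrM.
apply: ler_wpM2r g_ge0 _ _ _; near: c; apply: nbhs_pinfty_ge; exact: num_real.
Unshelve. all: by end_near. Qed.

End Asymptotics.

Local Open Scope classical_set_scope.

Theorem mainTheorem2 (R : realType) :
  exists P : nat -> nat,
    two_pow_O_nlgn R P /\
    forall (Sigma : finType) (A : omega_automaton Sigma),
      is_parity_automaton A ->
      exists C : omega_automaton Sigma,
        [/\ is_buchi_automaton C,
            (#|state C| <= P #|state A|)%N &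
            language C = ~` language A].
Proof.
exists (fun n => (2 * n + 2) ^ (4 * n))%N; split.
  exact: state_bound_two_pow_O_nlgn.
move=> Sigma A [k [G [B [chainGB accE]]]].
have accE' rho : acceptance (o := A) rho <-> ~ rejecting (prio G B) k rho.
  by rewrite accE; apply: parity_cond_prio.
exists (complement (prio G B)); split.
- by exists (comp_final A).
- exact: card_comp_state.
apply/seteqP; split=> w Lw.
  exact: (complement_sound accE' (prio_bound chainGB) Lw).
exact: (complement_complete accE' (chain_length chainGB) Lw).
Qed.
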